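(* Let $(A,\odot,\rightarrow,\rightsquigarrow,1)$ be a pseudo-hoop. Then $A$ is Archimedean if and only if $A$ is a linearly ordered Wajsberg pseudo-hoop (i.e. a Wajsberg pseudo-hoop whose order $\le$ is total).
   Context: A pseudo-hoop is an algebra $(A,\odot,\rightarrow,\rightsquigarrow,1)$ of type $(2,2,2,0)$ such that for all $x,y,z\in A$: $x\odot 1=1\odot x=x$; $x\rightarrow x=x\rightsquigarrow x=1$; $(x\odot y)\rightarrow z=x\rightarrow(y\rightarrow z)$; $(x\odot y)\rightsquigarrow z=y\rightsquigarrow(x\rightsquigarrow z)$; $(x\rightarrow y)\odot x=(y\rightarrow x)\odot y=x\odot(x\rightsquigarrow y)=y\odot(y\rightsquigarrow x)$. ($\odot$ binds more strongly than $\rightarrow,\rightsquigarrow$.) The relation $x\le y$ iff $x\rightarrow y=1$ (equivalently $x\rightsquigarrow y=1$) is a partial order on $A$. Put $x\vee_1 y=(x\rightarrow y)\rightsquigarrow y$ and $x\vee_2 y=(x\rightsquigarrow y)\rightarrow y$. $A$ is a Wajsberg pseudo-hoop if $x\vee_1 y=y\vee_1 x$ and $x\vee_2 y=y\vee_2 x$ for all $x,y\in A$. $A$ is Archimedean if for all $x,y\in A$: ($y\rightarrow x=x$ implies $x=1$ or $y=1$) and ($y\rightsquigarrow x=x$ implies $x=1$ or $y=1$). *)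

(* Defs.v *)
From mathcomp Require Import all_boot.

Set Implicit Arguments.
Unset Strict Implicit.
Unset Printing Implicit Defensive.

Declare Scope hoop_scope.
Delimit Scope hoop_scope with hoop.

(* The four-term divisibility equation
   (x → y) ⊙ x = (y → x) ⊙ y = x ⊙ (x ⇝ y) = y ⊙ (y ⇝ x)
   is split into hdivl, hdivlr and hdivr. *)
Record pseudo_hoop := PseudoHoop {
  hoop_sort :> Type;
  hmul : hoop_sort -> hoop_sort -> hoop_sort;
  himp : hoop_sort -> hoop_sort -> hoop_sort;
  hsimp : hoop_sort -> hoop_sort -> hoop_sort;
  hone : hoop_sort;
  hmulx1 : forall x, hmul x hone = x;
  hmul1x : forall x, hmul hone x = x;
  himpxx : forall x, himp x x = hone;
  hsimpxx : forall x, hsimp x x = hone;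
  himp_mul : forall x y z, himp (hmul x y) z = himp x (himp y z);
  hsimp_mul : forall x y z, hsimp (hmul x y) z = hsimp y (hsimp x z);
  hdivl : forall x y, hmul (himp x y) x = hmul (himp y x) y;
  hdivlr : forall x y, hmul (himp y x) y = hmul x (hsimp x y);
  hdivr : forall x y, hmul x (hsimp x y) = hmul y (hsimp y x)
}.

Arguments hone {p}.

Notation "x ⊙ y" := (hmul x y) (at level 40, left associativity) : hoop_scope.
Notation "x → y" := (himp x y) (at level 55, no associativity) : hoop_scope.
Notation "x ⇝ y" := (hsimp x y) (at level 55, no associativity) : hoop_scope.
Notation "1" := hone : hoop_scope.

Local Open Scope hoop_scope.

(* Equivalently x ⇝ y = 1 (hle_hsimp); hle is a partial order by hle_refl,
   hle_anti and hle_trans. *)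
Definition hle (A : pseudo_hoop) (x y : A) : Prop := x → y = 1.

Definition hjoin1 (A : pseudo_hoop) (x y : A) : A := (x → y) ⇝ y.
Definition hjoin2 (A : pseudo_hoop) (x y : A) : A := (x ⇝ y) → y.

Definition wajsberg (A : pseudo_hoop) : Prop :=
  forall x y : A, hjoin1 x y = hjoin1 y x /\ hjoin2 x y = hjoin2 y x.

Definition linearly_ordered (A : pseudo_hoop) : Prop :=
  forall x y : A, hle x y \/ hle y x.

Definition archimedean (A : pseudo_hoop) : Prop :=
  forall x y : A,
    (y → x = x -> x = 1 \/ y = 1) /\ (y ⇝ x = x -> x = 1 \/ y = 1).

Lemma hle_refl (A : pseudo_hoop) (x : A) : hle x x.
Proof. exact: himpxx. Qed.

Lemma hle_anti (A : pseudo_hoop) (x y : A) : hle x y -> hle y x -> x = y.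
Proof. by rewrite /hle => xy yx; have := hdivl x y; rewrite xy yx !hmul1x. Qed.

Lemma hmulA (A : pseudo_hoop) (x y z : A) : x ⊙ (y ⊙ z) = (x ⊙ y) ⊙ z.
Proof.
have E w : (x ⊙ (y ⊙ z)) → w = ((x ⊙ y) ⊙ z) → w by rewrite !himp_mul.
by apply: hle_anti; rewrite /hle; [rewrite E | rewrite -E]; rewrite himpxx.
Qed.

Lemma himp1x (A : pseudo_hoop) (x : A) : 1 → x = x.
Proof.
have e1 : (x → 1) ⊙ x = 1 → x by rewrite hdivl hmulx1.
have e2 : 1 → (x → 1) = x → 1 by rewrite -himp_mul hmul1x.
have e3 : ((x → 1) → 1) ⊙ (x → 1) = x → 1 by rewrite hdivl hmulx1 e2.
have e4 : ((1 → x) → x) ⊙ (1 → x) = x.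
  by rewrite hdivl -himp_mul hmulx1 himpxx hmul1x.
by rewrite -{2}e4 -{2 3}e1 himp_mul himpxx hmulA e3 e1.
Qed.

Lemma himpx1 (A : pseudo_hoop) (x : A) : x → 1 = 1.
Proof.
have e : (x → 1) ⊙ x = x by rewrite hdivl hmulx1 himp1x.
by rewrite -{1}e himp_mul himpxx.
Qed.

Lemma hsimp1x (A : pseudo_hoop) (x : A) : 1 ⇝ x = x.
Proof. by rewrite -[LHS]hmul1x -hdivlr himpx1 hmul1x. Qed.

Lemma hsimpx1 (A : pseudo_hoop) (x : A) : x ⇝ 1 = 1.
Proof.
have e : x ⊙ (x ⇝ 1) = x by rewrite hdivr hmul1x hsimp1x.
by rewrite -{1}e hsimp_mul hsimpxx.
Qed.

Lemma hle_hsimp (A : pseudo_hoop) (x y : A) : hle x y <-> x ⇝ y = 1.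
Proof.
rewrite /hle; split=> xy.
  have e : y ⊙ (y ⇝ x) = x by rewrite -hdivlr xy hmul1x.
  by rewrite -{1}e hsimp_mul hsimpxx hsimpx1.
have e : (y → x) ⊙ y = x by rewrite hdivlr xy hmulx1.
by rewrite -{1}e himp_mul himpxx himpx1.
Qed.

Lemma hle_trans (A : pseudo_hoop) (x y z : A) : hle x y -> hle y z -> hle x z.
Proof.
rewrite /hle => xy yz.
have e : (y → x) ⊙ y = x by rewrite -hdivl xy hmul1x.
by rewrite -{1}e himp_mul yz himpx1.
Qed.

(* Main.v *)
(** For [x ≤ u] divisibility gives [x = (u → x) ⊙ u], hence
    [x → y = (u → x) → (u → y)].  Take [y ≤ x] and [u = (x → y) ⇝ y]: then
    [u → y = x → y], so [x → y] is fixed by [(u → x) → _] and the Archimedean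
    property yields [u = x].  Since [_ → y] and [_ ⇝ y] are antitone, [hjoin1]
    is therefore a least upper bound, so it is commutative; [hjoin2] is
    [hjoin1] of the opposite pseudo-hoop.  For totality let [j] be the join of
    [x] and [y], [a = j → y], [b = j → x] and [c] the join of [a] and [b].
    Then [x = b ⊙ j] and [y = a ⊙ j] are below [c ⊙ j], so [c ⊙ j = j] and
    [c → b = (c ⊙ j) → x = b]: either [b = 1], or [c = 1], that is
    [a → b = b], and again [a] or [b] is [1]. *)
From mathcomp Require Import all_boot.
Require Import Defs.

Set Implicit Arguments.
Unset Strict Implicit.
Unset Printing Implicit Defensive.

Local Open Scope hoop_scope.

(** Both sides say [x ⊙ y ≤ z], by [himp_mul] and [hsimp_mul]. *)
Lemma hle_galois (A : pseudo_hoop) (x y z : A) :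
  hle x (y → z) <-> hle y (x ⇝ z).
Proof.
split=> h.
  by apply/hle_hsimp; rewrite -hsimp_mul; apply/hle_hsimp; rewrite /hle himp_mul.
by rewrite /hle -himp_mul; apply/hle_hsimp; rewrite hsimp_mul; apply/hle_hsimp.
Qed.

Lemma hle_hmul_himp (A : pseudo_hoop) (x y z : A) :
  hle (x ⊙ y) z <-> hle x (y → z).
Proof. by rewrite /hle himp_mul. Qed.

Lemma hle_himp (A : pseudo_hoop) (x y : A) : hle y (x → y).
Proof. by apply/hle_galois; rewrite hsimpxx; exact: himpx1. Qed.

Lemma hle_hjoin1l (A : pseudo_hoop) (x y : A) : hle x (hjoin1 x y).
Proof. by apply/hle_galois; exact: hle_refl. Qed.

Lemma hle_hjoin1r (A : pseudo_hoop) (x y : A) : hle y (hjoin1 x y).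
Proof. by apply/hle_galois; rewrite himpxx; exact: himpx1. Qed.

Lemma hmul_himp_le (A : pseudo_hoop) (x y : A) :
  hle x y -> (y → x) ⊙ y = x.
Proof. by move=> xy; rewrite -hdivl xy hmul1x. Qed.

Lemma himp_anti (A : pseudo_hoop) (x z y : A) :
  hle x z -> hle (z → y) (x → y).
Proof.
move=> xz; apply/hle_galois; apply: hle_trans xz _.
by apply/hle_galois; exact: hle_refl.
Qed.

Lemma hsimp_anti (A : pseudo_hoop) (x z y : A) :
  hle x z -> hle (z ⇝ y) (x ⇝ y).
Proof.
move=> xz; apply/hle_galois; apply: hle_trans xz _.
by apply/hle_galois; exact: hle_refl.
Qed.

Lemma hmul_monol (A : pseudo_hoop) (x y z : A) :
  hle x y -> hle (x ⊙ z) (y ⊙ z).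
Proof.
move=> xy; apply/hle_hmul_himp; apply: hle_trans xy _.
by apply/hle_hmul_himp; exact: hle_refl.
Qed.

Lemma hjoin1_himp (A : pseudo_hoop) (x y : A) : hjoin1 x y → y = x → y.
Proof.
apply: hle_anti; first exact: himp_anti (hle_hjoin1l x y).
by apply/hle_galois; exact: hle_refl.
Qed.

(** Reversing the product swaps [→] and [⇝]; by [hle_hsimp] the order stays the same. *)
Definition hoop_op (A : pseudo_hoop) : pseudo_hoop :=
  @PseudoHoop A (fun x y => hmul y x) (@hsimp A) (@himp A) hone
    (@hmul1x A) (@hmulx1 A) (@hsimpxx A) (@himpxx A)
    (fun x y z => hsimp_mul y x z) (fun x y z => himp_mul y x z)
    (@hdivr A) (fun x y => esym (hdivlr y x))
    (@hdivl A).

Definition archimedean_imp (A : pseudo_hoop) : Prop :=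
  forall x y : A, y → x = x -> x = 1 \/ y = 1.

Section ArchimedeanImp.

Variables (A : pseudo_hoop) (archA : archimedean_imp A).
Implicit Types x y z : A.

Lemma arch_hjoin1_le x y : hle y x -> hjoin1 x y = x.
Proof.
move=> yx; set u := hjoin1 x y.
have xu : hle x u by exact: hle_hjoin1l.
have : (u → x) → (x → y) = x → y.
  by rewrite -{1}(hjoin1_himp x y) -himp_mul hmul_himp_le.
(* If [x → y = 1], then [x = y] and [u = 1 ⇝ y = y]. *)
case/archA => [xy | ux]; last exact: hle_anti.
by rewrite /u /hjoin1 xy hsimp1x; exact: hle_anti.
Qed.

Lemma arch_hjoin1_lub x y z : hle x z -> hle y z -> hle (hjoin1 x y) z.
Proof.
by move=> xz /arch_hjoin1_le <-; apply: hsimp_anti; exact: himp_anti.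
Qed.

Lemma arch_hjoin1C x y : hjoin1 x y = hjoin1 y x.
Proof.
by apply: hle_anti; apply: arch_hjoin1_lub;
  (exact: hle_hjoin1l || exact: hle_hjoin1r).
Qed.

Lemma arch_linear : linearly_ordered A.
Proof.
move=> x y; set j := hjoin1 x y.
have xj : hle x j by exact: hle_hjoin1l.
have yj : hle y j by exact: hle_hjoin1r.
have ja : j → y = x → y by exact: hjoin1_himp.
have jb : j → x = y → x by rewrite /j arch_hjoin1C hjoin1_himp.
set a := j → y in ja; set b := j → x in jb; set c := hjoin1 a b.
(* The goal becomes [a = 1] or [b = 1]. *)
rewrite /hle -ja -jb.
have cj : c ⊙ j = j.
  apply: hle_anti; first by apply/hle_hmul_himp; rewrite himpxx; exact: himpx1.
  apply: arch_hjoin1_lub.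
    by rewrite -{1}(hmul_himp_le xj); apply: hmul_monol; exact: hle_hjoin1r.
  by rewrite -{1}(hmul_himp_le yj); apply: hmul_monol; exact: hle_hjoin1l.
have : c → b = b by rewrite /b -himp_mul cj.
case/archA => [-> | c1]; first by right.
(* [c = 1] reads [(a → b) ⇝ b = 1], that is [a → b ≤ b]. *)
have : a → b = b.
  by apply: hle_anti; [apply/hle_hsimp | exact: hle_himp].
by case/archA; [right | left].
Qed.

End ArchimedeanImp.

(** If [y → x = x], then [hjoin1 y x = x ⇝ x = 1], so [(x → y) ⇝ y = 1] by commutativity. For
    [x ≤ y] this reads [y = 1]; for [y ≤ x], already [x = y → x = 1]. *)
Lemma linear_wajsberg_archimedean_imp (A : pseudo_hoop) :
    (forall x y : A, hjoin1 x y = hjoin1 y x) -> linearly_ordered A ->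
  archimedean_imp A.
Proof.
move=> joinC linA x y yx; have := joinC y x.
rewrite /hjoin1 yx hsimpxx; case: (linA x y) => h.
  by rewrite h hsimp1x => <-; right.
by left; rewrite -yx.
Qed.

Theorem theorem3p20 (A : pseudo_hoop) :
  archimedean A <-> wajsberg A /\ linearly_ordered A.
Proof.
split=> [archA | [wajA linA] x y].
  have arch1 : archimedean_imp A by move=> x y; case: (archA x y).
  have arch2 : archimedean_imp (hoop_op A) by move=> x y; case: (archA x y).
  split; last exact: arch_linear.
  by move=> x y; split; [exact: arch_hjoin1C | exact: (arch_hjoin1C arch2)].
split.
  by apply: linear_wajsberg_archimedean_imp => // u v; case: (wajA u v).
apply: (@linear_wajsberg_archimedean_imp (hoop_op A)) => u v.
  by case: (wajA u v).
by case: (linA u v) => /hle_hsimp; [left | right].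
Qed.
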